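(* Let $\mathbf{M}$ be an infinite HPD matrix and let $\{\varphi_n(z)\}_{n=0}^{\infty}$ be the sequence of orthonormal polynomials associated with the inner product $\langle\cdot,\cdot\rangle_{\mathbf{M}}$ on $\mathbb{P}[z]$. Let $\mathcal{D}:\mathbb{P}[z]\to\mathbb{P}[z]$, $\mathcal{D}(p)(z)=zp(z)$, be the multiplication operator. If $\mathcal{D}$ is bounded on $\mathbb{P}[z]$ with respect to $\|\cdot\|_{\mathbf{M}}$, then the set of zeros of the orthonormal polynomials associated with $\mathbf{M}$ is bounded. Moreover, $$Z=\{z\in\mathbb{C}:\ \text{there exists } n\in\mathbb{N},\ \varphi_n(z)=0\}\subset\{z\in\mathbb{C}:\ |z|<\|\mathcal{D}\|\}.$$
   Context: $\mathbb{P}[z]$ is the space of polynomials in $z$ with complex coefficients; $c_{00}$ is the space of complex sequences (row vectors) with finitely many nonzero entries. An infinite Hermitian matrix $\mathbf{M}=(c_{i,j})_{i,j=0}^{\infty}$ is HPD (Hermitian positive definite) if all its finite truncated sections are positive definite. It defines an inner product on $\mathbb{P}[z]$ by $\langle p,q\rangle_{\mathbf{M}}=v\mathbf{M}w^*$ where $p(z)=\sum_n v_nz^n$, $q(z)=\sum_n w_nz^n$, with norm $\|p\|_{\mathbf{M}}^2=\langle p,p\rangle_{\mathbf{M}}$. The orthonormal polynomials $\varphi_n$ ($\deg\varphi_n=n$, positive leading coefficient) are obtained by Gram–Schmidt from $1,z,z^2,\dots$. $\mathcal{D}$ is bounded if $\|\mathcal{D}\|=\sup\{\|zp(z)\|_{\mathbf{M}}: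 p\in\mathbb{P}[z],\ \|p\|_{\mathbf{M}}=1\}<\infty$. *)

(* Defs.v *)
From HB Require Import structures.
From mathcomp Require Import all_boot all_order all_algebra.
From mathcomp Require Import all_classical all_reals all_analysis.
From mathcomp Require Import complex.

Set Implicit Arguments.
Unset Strict Implicit.
Unset Printing Implicit Defensive.

Import Order.TTheory GRing.Theory Num.Theory.
Import numFieldNormedType.Exports.
Import ComplexField.Normc.

Local Open Scope classical_set_scope.
Local Open Scope ring_scope.
Local Open Scope sesquilinear_scope.

Section InfiniteHPD.
Variable R : realType.
Local Notation C := (R[i]).

Definition infmx := nat -> nat -> C.

Implicit Types (M : infmx) (p q : {poly C}).

Definition truncation M (n : nat) : 'M[C]_n := \matrix_(i, j) M i j.

(* The order of R[i] is partial: 0 < z also says that z is real. *)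
Definition posdefmx (n : nat) (A : 'M[C]_n) : Prop :=
  A \is hermsymmx /\
  forall v : 'rV[C]_n, v != 0 -> 0 < (v *m A *m v ^t*) 0 0.

Definition HPD M : Prop :=
  (forall i j : nat, M i j = (M j i)^*) /\
  forall n : nat, posdefmx (truncation M n).

(* v M w^* for the finitely supported coefficient sequences v, w of p, q *)
Definition inner M p q : C :=
  \sum_(i < size p) \sum_(j < size q) p`_i * M i j * (q`_j)^*.

Definition pnorm M p : R := Num.sqrt (complex.Re (inner M p p)).

(* Gram-Schmidt applied to 1, 'X, ..., 'X^(n-1); the leading coefficient of
   each output is the inverse of a norm, hence positive when M is HPD. *)
Fixpoint gram_schmidt M (n : nat) : seq {poly C} :=
  if n is k.+1 then
    let s := gram_schmidt M k in
    let r := 'X^k - \sum_(u <- s) inner M 'X^k u *: u in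
    rcons s (((pnorm M r)^-1)%:C%C *: r)
  else [::].

Definition orthonormal_poly M (n : nat) : {poly C} :=
  (gram_schmidt M n.+1)`_n.

Definition mulX (p : {poly C}) : {poly C} := 'X * p.

Definition opnorm M (T : {poly C} -> {poly C}) : \bar R :=
  ereal_sup [set (pnorm M (T p))%:E | p in [set p | pnorm M p = 1]].

Definition bounded_op M (T : {poly C} -> {poly C}) : Prop :=
  (opnorm M T < +oo)%E.

(* C^o is the complex field as a normed space over itself. *)
Definition zeros M : set C^o :=
  [set z | exists n : nat, root (orthonormal_poly M n) z].

End InfiniteHPD.

(* Main.v *)
(* If phi_n(z) = 0, write phi_n = (X - z) q with deg q < n. Then
   X q = phi_n + z q and phi_n is orthogonal to q, so by Pythagoras
   ||X q||^2 = 1 + |z|^2 ||q||^2 > |z|^2 ||q||^2, whence ||D|| > |z|. *)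
Require Import Defs.
From HB Require Import structures.
From mathcomp Require Import all_boot all_order all_algebra.
From mathcomp Require Import all_classical all_reals all_analysis.
From mathcomp Require Import complex.

Set Implicit Arguments.
Unset Strict Implicit.
Unset Printing Implicit Defensive.

Import Order.TTheory GRing.Theory Num.Theory.
Import numFieldNormedType.Exports.
Import ComplexField.Normc.

Local Open Scope classical_set_scope.
Local Open Scope ring_scope.

Section InnerProduct.
Variables (R : realType) (M : infmx R).
Hypothesis HM : HPD M.
Local Notation C := (R[i]).
Implicit Types (p q u : {poly C}) (c : C).

(** Coefficients past the size are 0, so both sums may run to any common bound. This lets forms of
    polynomials of different sizes be compared term by term. *)
Lemma inner_widen n p q : (size p <= n)%N -> (size q <= n)%N ->
  inner M p q = \sum_(i < n) \sum_(j < n) p`_i * M i j * (q`_j)^*.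
Proof.
move=> sp sq; rewrite /inner.
rewrite (big_ord_widen n
  (fun i => \sum_(j < size q) p`_i * M i j * (q`_j)^*) sp) big_mkcond /=.
apply: eq_bigr => i _; case: ltnP => [_|le_p_i]; last first.
  by rewrite big1 // => j _; rewrite nth_default // !mul0r.
rewrite (big_ord_widen n (fun j => p`_i * M i j * (q`_j)^*) sq) big_mkcond /=.
by apply: eq_bigr => j _; case: ltnP => // le_q_j;
  rewrite [q`_j]nth_default // conjC0 mulr0.
Qed.

Lemma innerDl p q u : inner M (p + q) u = inner M p u + inner M q u.
Proof.
set n := maxn (maxn (size p) (size q)) (size u).
have [sp sq su] : [/\ size p <= n, size q <= n & size u <= n]%N.
  by rewrite !leq_max !leqnn ?orbT.
rewrite !(@inner_widen n) //; last first.
  by apply: leq_trans (size_polyD p q) _; rewrite geq_max sp.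
rewrite -big_split; apply: eq_bigr => i _; rewrite -big_split.
by apply: eq_bigr => j _; rewrite coefD !mulrDl.
Qed.

Lemma innerZl c p u : inner M (c *: p) u = c * inner M p u.
Proof.
rewrite !(@inner_widen (maxn (size p) (size u))) ?leq_max ?leqnn ?orbT //.
  rewrite mulr_sumr; apply: eq_bigr => i _; rewrite mulr_sumr.
  by apply: eq_bigr => j _; rewrite coefZ !mulrA.
by rewrite size_scale_leq.
Qed.

Lemma inner0l u : inner M 0 u = 0.
Proof. by rewrite -(scale0r 0) innerZl mul0r. Qed.

Lemma inner_suml (I : finType) (F : I -> {poly C}) u :
  inner M (\sum_i F i) u = \sum_i inner M (F i) u.
Proof.
apply: (big_morph (inner M ^~ u)) => [p q|]; [exact: innerDl | exact: inner0l].
Qed.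

Lemma inner_conj p q : inner M p q = (inner M q p)^*.
Proof.
rewrite /inner rmorph_sum exchange_big; apply: eq_bigr => i _.
rewrite rmorph_sum; apply: eq_bigr => j _.
by rewrite !rmorphM /= conjCK -(proj1 HM) mulrC mulrA mulrAC.
Qed.

Lemma innerDr p q u : inner M u (p + q) = inner M u p + inner M u q.
Proof. by rewrite inner_conj innerDl rmorphD /= -!inner_conj. Qed.

Lemma innerZr c p u : inner M u (c *: p) = c^* * inner M u p.
Proof. by rewrite inner_conj innerZl rmorphM /= -inner_conj. Qed.

(** The value is the quadratic form of the truncation of order [size p] at the coefficient row of
    [p], which is nonzero because its last entry is the leading coefficient. *)
Lemma inner_gt0 p : p != 0 -> 0 < inner M p p.
Proof.
move=> p_neq0; pose v := \row_(i < size p) p`_i.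
have v_neq0 : v != 0.
  have lt_p : ((size p).-1 < size p)%N by rewrite prednK // lt0n size_poly_eq0.
  apply: contraNneq p_neq0 => /rowP/(_ (Ordinal lt_p)).
  by rewrite !mxE /= => /eqP; rewrite lead_coef_eq0.
have [_ /(_ v v_neq0)] := proj2 HM (size p).
congr (0 < _); rewrite mxE /inner exchange_big; apply: eq_bigr => j _.
rewrite !mxE mulr_suml; apply: eq_bigr => i _.
by rewrite !mxE.
Qed.

Lemma pnorm_gt0 p : p != 0 -> 0 < pnorm M p.
Proof.
move/inner_gt0 => pp_gt0; rewrite sqrtr_gt0.
by move: pp_gt0; case: (inner M p p) => a b; rewrite ltcE => /andP[].
Qed.

(** Positivity in [R[i]] forces the imaginary part to vanish, so the real part taken in [pnorm]
    loses nothing. *)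
Lemma innerpp p : inner M p p = (pnorm M p ^+ 2)%:C%C.
Proof.
have [->|/inner_gt0] := eqVneq p 0.
  by rewrite /pnorm /inner size_poly0 big_ord0 sqrtr0 expr0n.
rewrite /pnorm; case: (inner M p p) => a b; rewrite ltcE => /andP[/eqP /= -> ?].
by rewrite sqr_sqrtr // ltW.
Qed.

Lemma pnormZ (a : R) p : 0 <= a -> pnorm M (a%:C%C *: p) = a * pnorm M p.
Proof.
move=> a_ge0; apply/eqP.
rewrite -(@eqrXn2 _ 2) ?mulr_ge0 ?sqrtr_ge0 // -(inj_eq (@complexI R)).
rewrite -innerpp innerZl innerZr innerpp exprMn -[_^*]/(a%:C%C^*)%C.
by rewrite conjc_real mulrA [a ^+ 2]expr2 !rmorphM.
Qed.

(** Each stage of [gram_schmidt] only appends to the previous list, so stage [m] lists the first [m]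
    orthonormal polynomials and the recursion becomes the usual Gram-Schmidt formula. *)
Lemma orthonormal_polyE n :
  orthonormal_poly M n =
  let r := 'X^n -
    \sum_(k < n) inner M 'X^n (orthonormal_poly M k) *: orthonormal_poly M k in
  ((pnorm M r)^-1)%:C%C *: r.
Proof.
have size_gs m : size (gram_schmidt M m) = m.
  by elim: m => //= m IHm; rewrite size_rcons IHm.
have gsE m : gram_schmidt M m = mkseq (orthonormal_poly M) m.
  elim: m => // m IHm; rewrite mkseqS -IHm /orthonormal_poly /= nth_rcons.
  by rewrite size_gs ltnn eqxx.
rewrite {1}/orthonormal_poly /= nth_rcons size_gs ltnn eqxx gsE big_map.
have -> : iota 0 n = index_iota 0 n by rewrite /index_iota subn0.
by rewrite big_mkord.
Qed.

Lemma orthonormal_polyP n :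
  [/\ size (orthonormal_poly M n) = n.+1,
      pnorm M (orthonormal_poly M n) = 1 &
      forall k, (k < n)%N ->
        inner M (orthonormal_poly M n) (orthonormal_poly M k) = 0].
Proof.
elim/ltn_ind: n => n IHn; rewrite orthonormal_polyE.
set r := 'X^n - _ => /=.
(* By induction every subtracted term has size at most [n], so 'X^n keeps the top coefficient. *)
have size_r : size r = n.+1.
  rewrite size_polyDl ?size_polyXn // size_polyN ltnS.
  apply: (leq_trans (size_sum _ _ _)); apply/bigmax_leqP => k _.
  by apply: leq_trans (size_scale_leq _ _) _; have [->] := IHn k (ltn_ord k).
have r_neq0 : r != 0 by rewrite -size_poly_eq0 size_r.
have r_gt0 := pnorm_gt0 r_neq0.
split=> [||k lt_kn].
- by rewrite size_scale // (inj_eq (@complexI R) _ 0) invr_eq0 gt_eqF.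
- by rewrite pnormZ ?invr_ge0 ?ltW // mulVf // gt_eqF.
rewrite innerZl.
suff -> : inner M r (orthonormal_poly M k) = 0 by rewrite mulr0.
(* Only the term of index [k] survives in the sum; as [orthonormal_poly M k] has norm 1, it cancels
   the contribution of 'X^n. *)
rewrite /r innerDl -scaleN1r innerZl inner_suml (bigD1 (Ordinal lt_kn)) //=.
rewrite innerZl innerpp; have [_ -> orth_k] := IHn k lt_kn.
rewrite big1 ?expr1n ?addr0 ?mulr1 ?mulN1r ?subrr // => j neq_jk.
have [_ _ orth_j] := IHn j (ltn_ord j).
(* The induction hypothesis gives orthogonality only with the smaller index on the right; the other
   order follows by conjugation. *)
rewrite innerZl; case: (ltngtP j k) => [lt_jk|lt_kj|eq_jk].
- by rewrite [X in _ * X]inner_conj orth_k // conjC0 mulr0.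
- by rewrite orth_j // mulr0.
- by case/eqP: neq_jk; apply: val_inj.
Qed.

(** The polynomials of index below [n] have every degree below [n], so they span all such [p]; the
    induction on [m] peels off one top coefficient at a time. *)
Lemma orthonormal_poly_orth n p : (size p <= n)%N ->
  inner M (orthonormal_poly M n) p = 0.
Proof.
have [_ _ orth] := orthonormal_polyP n.
suff orth_le m : (m <= n)%N -> forall p, (size p <= m)%N ->
    inner M (orthonormal_poly M n) p = 0 by exact: orth_le.
elim: m => [_|m IHm lt_mn] {}p.
  rewrite leqn0 size_poly_eq0 => /eqP->.
  by rewrite inner_conj inner0l conjC0.
move=> size_p; set u := orthonormal_poly M m.
have [size_u _ _] := orthonormal_polyP m.
have um_neq0 : u`_m != 0.
  by rewrite -[m]/(m.+1.-1) -size_u lead_coef_eq0 -size_poly_eq0 size_u.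
(* This choice cancels the coefficient of degree [m] in [p - c *: u], whose size is then at most
   [m]. *)
pose c := p`_m / u`_m.
rewrite -(subrK (c *: u) p) innerDr innerZr orth // mulr0 addr0.
apply: IHm; first exact: ltnW.
apply/leq_sizeP => j; rewrite leq_eqVlt coefB coefZ => /predU1P[<-|lt_mj].
  by rewrite divfK ?subrr.
by rewrite !nth_default ?mulr0 ?subrr // ?size_u // (leq_trans size_p).
Qed.

Lemma pnorm_mulX_root n (z : C) q :
  orthonormal_poly M n = q * ('X - z%:P) ->
  q != 0 /\ pnorm M (mulX q) ^+ 2 = 1 + (normc z * pnorm M q) ^+ 2.
Proof.
move=> phiE; have [size_phi norm_phi _] := orthonormal_polyP n.
have q_neq0 : q != 0.
  by apply: contra_eq_neq size_phi => q0; rewrite phiE q0 mul0r size_poly0.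
split=> //.
(* The monic factor of size 2 makes the size of [q] one less than [n.+1], just small enough for
   orthogonality to [orthonormal_poly M n]. *)
have size_q : (size q <= n)%N.
  by rewrite -ltnS -size_phi phiE size_Mmonic ?monicXsubC // size_XsubC addn2.
have XqE : mulX q = orthonormal_poly M n + z *: q.
  by rewrite phiE mulrBr -mul_polyC [q * z%:P]mulrC subrK /mulX mulrC.
apply: (@complexI R); rewrite -innerpp XqE.
rewrite innerDl !innerDr !innerZl !innerZr.
rewrite [inner M q (orthonormal_poly M n)]inner_conj.
rewrite (orthonormal_poly_orth size_q) conjC0 !mulr0 add0r addr0 !innerpp.
rewrite norm_phi.
rewrite expr1n exprMn rmorphD /=; congr (_ + _).
by rewrite mulrA -normCK !rmorphM.
Qed.

Lemma zeros_lt_opnorm (z : C) :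
  zeros M z -> ((normc z)%:E < opnorm M (@mulX R))%E.
Proof.
case=> n /factor_theorem[q /pnorm_mulX_root[/pnorm_gt0 q_gt0 normXq]].
(* Normalizing [q] gives a competitor in the supremum. The summand 1 in [normXq] makes the
   inequality strict already at [p], whether or not the supremum is attained. *)
pose p := ((pnorm M q)^-1)%:C%C *: q.
have iq_ge0 : 0 <= (pnorm M q)^-1 by rewrite invr_ge0 ltW.
have z_ge0 : 0 <= normc z by case: (z) => a b; rewrite sqrtr_ge0.
apply: (@lt_le_trans _ _ (pnorm M (mulX p))%:E); last first.
  apply: ereal_sup_ubound; exists p => //=.
  by rewrite pnormZ // mulVf // gt_eqF.
have -> : mulX p = ((pnorm M q)^-1)%:C%C *: mulX q by rewrite /mulX -scalerAr.
rewrite lte_fin pnormZ // mulrC ltr_pdivlMr //.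
rewrite -(@ltr_pXn2r _ 2) ?nnegrE ?mulr_ge0 ?sqrtr_ge0 ?(ltW q_gt0) // normXq.
by rewrite ltrDr.
Qed.

End InnerProduct.

Theorem proposition1 (R : realType) (M : infmx R) :
  HPD M ->
  bounded_op M (@mulX R) ->
  bounded_set (zeros M) /\
  zeros M `<=` [set z | ((normc z)%:E < opnorm M (@mulX R))%E].
Proof.
move=> HM bndD; split; last by move=> z; exact: zeros_lt_opnorm.
(* A bound for a set in [C^o] is itself a complex number that must be shown real, hence the
   embedding of the finite operator norm. *)
exists (fine (opnorm M (@mulX R)))%:C%C; split.
  by apply/complex_realP; exists (fine (opnorm M (@mulX R))).
move=> B ltB z /(zeros_lt_opnorm HM) lt_z; apply/ltW/le_lt_trans/ltB.
rewrite -[`|_|]/((normc z)%:C%C) lecR -lee_fin fineK ?ltW //.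
(* The operator norm is below [+oo] by boundedness and above [-oo] because it exceeds the modulus of
   the zero [z] at hand. *)
rewrite fin_real // bndD andbT.
exact: lt_trans (ltNyr _) lt_z.
Qed.
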